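(* Suppose $\dim(R/I)=2$, $A=K[x_{n-1},x_n]$ is a Noether normalization of $R/I$, and $x_n$ is a nonzero divisor on $R/I$. Let $\mathcal G$ be a Gröbner basis of $I$ with respect to $>_\omega$. For each $u\in\mathcal B_1$ let $\delta_u:=\min\{\delta \mid u\,x_{n-1}^{\delta}\in \mathrm{in}(I)\}$. Then $$0\longrightarrow \bigoplus_{u\in\mathcal B_1}A(-\deg_\omega(u)-\delta_u\omega_{n-1})\xrightarrow{\ \psi_1\ }\bigoplus_{v\in\mathcal B_0}A(-\deg_\omega(v))\xrightarrow{\ \psi_0\ }R/I\longrightarrow 0$$ is the Noether resolution of $R/I$, where $\psi_0$ is the homomorphism of $A$-modules given by $e_v\mapsto v+I$ for $v\in\mathcal B_0$, and $\psi_1$ is the homomorphism of $A$-modules given by $$e_u\mapsto x_{n-1}^{\delta_u}e_u-\sum_{v\in\mathcal B_0}f_{u_v}e_v \qquad (u\in\mathcal B_1),$$ whenever $\sum_{v\in\mathcal B_0}f_{u_v}v$, with $f_{u_v}\in A$, is the remainder of the division of $u\,x_{n-1}^{\delta_u}$ by $\mathcal G$.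
   Context: $K$ is an infinite field, $R=K[x_1,\dots,x_n]$, $\omega=(\omega_1,\dots,\omega_n)\in(\mathbb Z^+)^n$, and $I\subset R$ is an $\omega$-homogeneous ideal, i.e. homogeneous for the grading $\deg_\omega(x_i)=\omega_i$. That $A=K[x_{n-1},x_n]$ is a Noether normalization of $R/I$ means that $A\hookrightarrow R/I$ is an integral ring extension. The Noether resolution of $R/I$ is the minimal graded free resolution of $R/I$ as an $A$-module (with respect to $\deg_\omega$). The weighted degree reverse lexicographic order $>_\omega$: $x^\alpha>_\omega x^\beta$ iff $\deg_\omega(x^\alpha)>\deg_\omega(x^\beta)$, or $\deg_\omega(x^\alpha)=\deg_\omega(x^\beta)$ and the last nonzero entry of $\alpha-\beta\in\mathbb Z^n$ is negative. For an ideal $J'$, $\mathrm{in}(J')$ denotes its initial ideal with respect to $>_\omega$. $\mathcal B_0$ is the (finite) set of monomials of $R$ not belonging to $\mathrm{in}(I+(x_{n-1},x_n))$. Let $\chi:R\to R$ be the evaluation morphism with $x_i\mapsto x_i$ for $i\in\{1,\dots,n-2\}$ and $x_{n-1},x_n\mapsto 1$, let $J:=\chi(\mathrm{in}(I))\cdot R$, and set $\mathcal B_1:=\mathcal B_0\cap J$. In each free module, $e_v$ denotes the canonical basis element indexed by $v$. *)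

(* Defs.v *)
From HB Require Import structures.
From mathcomp Require Import all_boot all_order all_algebra.
From mathcomp Require Import finmap.
From mathcomp Require Import ssrcomplements freeg mpoly.

Set Implicit Arguments.
Unset Strict Implicit.
Unset Printing Implicit Defensive.

Import GRing.Theory.

Local Open Scope ring_scope.
Local Open Scope quotient_scope.

(* Ideals built from other ideals (sums, initial ideals, extensions) may be
   improper or undecidable, so they are Prop-valued predicates; only the ideal
   one quotients by uses MathComp's [idealr]. *)
Definition ideal_gen (R : comNzRingType) (S : R -> Prop) (p : R) : Prop :=
  exists2 s : seq (R * R),
    (forall x, x \in s -> S x.2) & p = \sum_(x <- s) x.1 * x.2.

Definition ideal_sum (R : comNzRingType) (J1 J2 : R -> Prop) (p : R) : Prop :=
  exists p1 p2, [/\ J1 p1, J2 p2 & p = p1 + p2].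

Definition prime_ideal (R : comNzRingType) (P : {pred R}) : Prop :=
  idealr_closed P /\ prime_idealr_closed P.

(* P 0 < P 1 < ... < P l, strict inclusions of prime ideals *)
Definition prime_chain (R : comNzRingType) (l : nat) (P : nat -> {pred R}) :=
  (forall i, (i <= l)%N -> prime_ideal (P i)) /\
  (forall i, (i < l)%N ->
     {subset P i <= P i.+1} /\ exists2 x, x \in P i.+1 & x \notin P i).

Definition krull_dim_eq (R : comNzRingType) (d : nat) : Prop :=
  (exists P, @prime_chain R d P) /\
  (forall l P, @prime_chain R l P -> (l <= d)%N).

Section WeightedDegree.
Variables (n : nat) (w : 'I_n -> nat).

Definition wdeg (m : 'X_{1..n}) : nat := (\sum_(i < n) m i * w i)%N.

Fact wdeg0 : wdeg 0%MM = 0%N.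
Proof. by rewrite /wdeg big1 // => i _; rewrite mnm0E. Qed.

Fact wdegD : {morph wdeg : m1 m2 / (m1 + m2)%MM >-> (m1 + m2)%N}.
Proof.
move=> m1 m2; rewrite /wdeg -big_split /=; apply: eq_bigr => i _.
by rewrite mnmDE mulnDl.
Qed.

HB.instance Definition _ := isMeasure.Build n wdeg wdeg0 wdegD.

Definition whomogeneous_ideal (K : fieldType) (J : {mpoly K[n]} -> Prop) :=
  forall p d, J p -> J (pihomog wdeg d p).

(* The weighted degree reverse lexicographic order; MathComp's own order and
   [mlead] on multinomials are those of the unweighted degree. *)
Definition wrevlex_gt (a b : 'X_{1..n}) : bool :=
  (wdeg b < wdeg a)%N ||
  (wdeg a == wdeg b) &&
  [exists i : 'I_n,
     (a i < b i)%N && [forall j : 'I_n, (i < j)%N ==> (a j == b j)]].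

Section Groebner.
Variable K : fieldType.
Implicit Types (p r f : {mpoly K[n]}) (G : seq {mpoly K[n]}).

(* m is the leading monomial of p (in particular p != 0) *)
Definition is_lead_mnm p (m : 'X_{1..n}) : Prop :=
  m \in msupp p /\ forall m', m' \in msupp p -> m' != m -> wrevlex_gt m m'.

Definition initial_ideal (S : {mpoly K[n]} -> Prop) : {mpoly K[n]} -> Prop :=
  ideal_gen (fun q => exists p m, [/\ S p, is_lead_mnm p m & q = 'X_[m]]).

Definition groebner_basis (J : {mpoly K[n]} -> Prop) G : Prop :=
  (forall g, g \in G -> J g) /\
  (forall p, initial_ideal J p <-> initial_ideal (fun g => g \in G) p).

(* r is a remainder of the division of f by G, as produced by the multivariate
   division algorithm *)
Definition is_remainder G f r : Prop :=
  exists q : 'I_(size G) -> {mpoly K[n]},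
  [/\ f = \sum_(i < size G) q i * G`_i + r,
      (forall i m m', is_lead_mnm (q i * G`_i) m -> is_lead_mnm f m' ->
         (m == m') || wrevlex_gt m' m) &
      (forall g m m', g \in G -> is_lead_mnm g m -> m' \in msupp r ->
         ~~ (m <= m')%MM)].

End Groebner.
End WeightedDegree.

Section FreeModule.
Variables (A : comNzRingType) (T : finType).

Definition hom_of_basis (M : lmodType A) (b : T -> M)
  (g : {ffun T -> A^o}) : M := \sum_(t : T) (g t : A) *: b t.

Fact hom_of_basis_is_linear M b : linear (@hom_of_basis M b).
Proof.
move=> a g h; rewrite /hom_of_basis scaler_sumr -big_split /=.
by apply: eq_bigr => t _; rewrite !ffunE scalerDl scalerA.
Qed.

HB.instance Definition _ (M : lmodType A) (b : T -> M) :=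
  GRing.isLinear.Build A {ffun T -> A^o} M *:%R (@hom_of_basis M b)
    (hom_of_basis_is_linear b).

End FreeModule.

(* e_v, for v a member of the finite index set B (and 0 when v \notin B) *)
Definition basis_vec (A : comNzRingType) (n : nat) (B : {fset 'X_{1..n}})
  (v : 'X_{1..n}) : {ffun B -> A^o} := [ffun t => (val t == v)%:R].

Section GradedResolution.
Variables (K : fieldType) (k : nat) (w : 'I_k -> nat).
Local Notation A := {mpoly K[k]}.

(* The degree d part of the graded free module \bigoplus_t A(- s t), where
   A(- s)_d = A_(d - s). *)
Definition free_homog (T : finType) (s : T -> nat) (d : nat)
  (g : {ffun T -> A^o}) : Prop :=
  forall t m, m \in msupp (g t : A) -> (wdeg w m + s t = d)%N.

(* 0 -> \bigoplus_t A(- s1 t) -psi1-> \bigoplus_t A(- s0 t) -psi0-> M -> 0 is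
   a minimal graded free resolution of M, whose degree d part is [Mhomog d].
   When the weights are positive, the homogeneous maximal ideal of A is
   { a | a@_0 = 0 }, so the last clause says that psi1 has image in
   (x_1, .., x_k) F0. *)
Definition minimal_graded_free_resolution
    (M : lmodType A) (Mhomog : nat -> M -> Prop)
    (T0 T1 : finType) (s0 : T0 -> nat) (s1 : T1 -> nat)
    (psi1 : {linear {ffun T1 -> A^o} -> {ffun T0 -> A^o}})
    (psi0 : {linear {ffun T0 -> A^o} -> M}) : Prop :=
  [/\ (forall d g, free_homog s1 d g -> free_homog s0 d (psi1 g))
      /\ (forall d g, free_homog s0 d g -> Mhomog d (psi0 g)),
      injective psi1,
      (forall g, psi0 g = 0 <-> exists h, g = psi1 h),
      (forall z, exists g, psi0 g = z) &
      (forall h t, (psi1 h t : A)@_0%MM = 0)].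

End GradedResolution.

(* R = K[x_1, .., x_(n+2)] and A = K[x_(n+1), x_(n+2)], so that n + 2 is the
   number of variables; [rshift n] includes the variables of A into those of
   R. *)
Section LastTwoVariables.
Variables (K : fieldType) (n : nat).
Local Notation R := {mpoly K[n + 2]}.
Local Notation A := {mpoly K[2]}.

Definition penult_var : 'I_(n + 2) := rshift n ord0.
Definition last_var : 'I_(n + 2) := rshift n ord_max.

Definition iotaA : A -> R := comp_mpoly [tuple 'X_(rshift n j) | j < 2].

HB.instance Definition _ := GRing.RMorphism.on iotaA.

Definition chi : R -> R :=
  comp_mpoly [tuple (if (i < n)%N then 'X_i else 1) | i < n + 2].

Section Quotient.
Variable I : idealr R.

(* R/I as a ring, and as an A-module *)
Definition quo : Type := {ideal_quot I}.

HB.instance Definition _ := GRing.ComNzRing.on quo.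

Definition cls (p : R) : quo := \pi_{ideal_quot I} p.

HB.instance Definition _ := GRing.RMorphism.copy cls \pi_{ideal_quot I}.

Definition structA (a : A) : quo := cls (iotaA a).

HB.instance Definition _ := GRing.RMorphism.copy structA (cls \o iotaA).

Definition quo_scale (a : A) (z : quo) : quo := structA a * z.

Fact quo_scaleA a b z : quo_scale a (quo_scale b z) = quo_scale (a * b) z.
Proof. by rewrite /quo_scale rmorphM mulrA. Qed.
Fact quo_scale1 : left_id 1 quo_scale.
Proof. by move=> z; rewrite /quo_scale rmorph1 mul1r. Qed.
Fact quo_scaleDr : right_distributive quo_scale +%R.
Proof. by move=> a y z; rewrite /quo_scale mulrDr. Qed.
Fact quo_scaleDl z : {morph quo_scale^~ z : a b / a + b}.
Proof. by move=> a b; rewrite /quo_scale rmorphD mulrDl. Qed.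

HB.instance Definition _ := GRing.Zmodule_isLmodule.Build A quo
  quo_scaleA quo_scale1 quo_scaleDr quo_scaleDl.

Definition noether_normalization : Prop :=
  injective structA /\ integralRange structA.

Variable w : 'I_(n + 2) -> nat.

Definition quo_homog (d : nat) (z : quo) : Prop :=
  exists2 p : R, p \is d.-homog for (wdeg w) & z = cls p.

(* in(I) *)
Definition initI : R -> Prop := initial_ideal w (fun p => p \in I).

Definition inB0 (u : 'X_{1..n + 2}) : Prop :=
  ~ initial_ideal w
      (ideal_sum (fun p => p \in I)
         (ideal_gen (fun q => q = 'X_penult_var \/ q = 'X_last_var))) 'X_[u].

Definition inB1 (u : 'X_{1..n + 2}) : Prop :=
  inB0 u /\ ideal_gen (fun q => exists2 p, initI p & q = chi p) 'X_[u].

Definition is_delta (u : 'X_{1..n + 2}) (d : nat) : Prop :=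
  initI ('X_[u] * 'X_penult_var ^+ d) /\
  forall d', initI ('X_[u] * 'X_penult_var ^+ d') -> (d <= d')%N.

Definition noether_resolution := @minimal_graded_free_resolution K 2
  (fun j => w (rshift n j)) quo quo_homog.

Variables B0 B1 : {fset 'X_{1..n + 2}}.

Definition psi0 : {ffun B0 -> A^o} -> quo :=
  hom_of_basis (fun v : B0 => cls 'X_[val v]).

HB.instance Definition _ := GRing.Linear.on psi0.

Definition psi1 (delta : B1 -> nat) (f : B1 -> B0 -> A) :
    {ffun B1 -> A^o} -> {ffun B0 -> A^o} :=
  hom_of_basis (fun u : B1 =>
    ('X_ord0 ^+ delta u : A) *: basis_vec A B0 (val u)
    - \sum_(v : B0) f u v *: basis_vec A B0 (val v)).

HB.instance Definition _ delta f := GRing.Linear.on (psi1 delta f).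

(* For every u, sum_v f_(u_v) v is the remainder of the division of
   u x_(n+1)^(delta u) by G. *)
Definition division_coeffs (G : seq R) (delta : B1 -> nat)
    (f : B1 -> B0 -> A) : Prop :=
  forall u : B1, is_remainder w G
    ('X_[val u] * 'X_penult_var ^+ delta u)
    (\sum_(v : B0) iotaA (f u v) * 'X_[val v]).

End Quotient.
End LastTwoVariables.

Arguments psi0 {K n} I B0.

(* Main.v *)
(* Write y, z for the last two variables.  Since z is regular and I is
   homogeneous, u z in in(I) implies u in in(I), because in the reverse
   lexicographic order z divides a homogeneous polynomial as soon as it divides
   its leading monomial.  Likewise in(I + (y, z)) is in(I) + (y, z).  Hence the
   monomials outside in(I) are the u y^a z^b with u in B0 and, for u in B1,
   a < delta_u; they form a K-basis of R/I, so B0 generates R/I over A.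
   A relation g between the elements of B0 is a polynomial of I whose monomials
   are v y^a z^b with v in B0; if it is nonzero, its leading monomial is
   u y^(delta_u) y^a z^b with u in B1, and subtracting a multiple of
   psi1(e_u), whose leading monomial is u y^(delta_u), lowers it.  This gives
   exactness in the middle.  The leading monomials u y^(delta_u) of the psi1(e_u)
   are distinct in their first n variables, which gives injectivity, and every
   monomial of psi1(e_u) is divisible by y or z, which gives minimality. *)
From HB Require Import structures.
Require Import Defs.
From mathcomp Require Import all_boot all_order all_algebra.
From mathcomp Require Import finmap.
From mathcomp Require Import ssrcomplements freeg mpoly.

Set Implicit Arguments.
Unset Strict Implicit.
Unset Printing Implicit Defensive.

Import GRing.Theory.

Local Open Scope ring_scope.

(** * The weighted reverse lexicographic order as a monomial well-order *)

Section WeightedRevlex.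
Variables (k : nat) (w : 'I_k -> nat).
Implicit Types a b c m : 'X_{1..k}.
Local Notation gt := (wrevlex_gt w).

Lemma wrevlex_gtP a b :
  reflect ((wdeg w b < wdeg w a)%N \/ wdeg w a = wdeg w b /\
             exists2 i : 'I_k, (a i < b i)%N &
               forall j : 'I_k, (i < j)%N -> a j = b j)
          (gt a b).
Proof.
apply: (iffP orP) => -[lt_ba|]; [by left| |by left|].
  case/andP=> /eqP eq_ab /existsP[i /andP[lt_i /forallP eq_j]]; right.
  by split=> //; exists i => // j lt_ij; apply/eqP/(implyP (eq_j j)).
case=> eq_ab [i lt_i eq_j]; right; rewrite eq_ab eqxx /=.
apply/existsP; exists i; rewrite lt_i /=.
by apply/forallP => j; apply/implyP => /eq_j/eqP.
Qed.

Lemma wrevlex_gtxx a : gt a a = false.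
Proof.
by apply/negP => /wrevlex_gtP[|[_ [i]]]; rewrite ltnn.
Qed.

Lemma wrevlex_gt_wdeg a b : gt a b -> (wdeg w b <= wdeg w a)%N.
Proof. by case/wrevlex_gtP => [/ltnW|[->]]. Qed.

Lemma wrevlex_gt_trans b a c : gt a b -> gt b c -> gt a c.
Proof.
case/wrevlex_gtP=> [lt_ba /wrevlex_gt_wdeg le_cb|].
  by apply/wrevlex_gtP; left; apply: leq_ltn_trans le_cb lt_ba.
case=> eq_ab [i lt_i eq_i] /wrevlex_gtP[lt_cb|].
  by apply/wrevlex_gtP; left; rewrite eq_ab.
case=> eq_bc [j lt_j eq_j]; apply/wrevlex_gtP; right.
split; first by rewrite eq_ab.
(* The larger of the two deciding indices decides between [a] and [c]. *)
have [lt_ij|lt_ji|/val_inj eq_ij] := ltngtP i j.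
- exists j; first by rewrite eq_i.
  by move=> l lt_jl; rewrite eq_i ?eq_j // (ltn_trans lt_ij).
- exists i; first by rewrite -eq_j.
  by move=> l lt_il; rewrite eq_i ?eq_j // (ltn_trans lt_ji).
- exists i; first by rewrite (ltn_trans lt_i) // eq_ij.
  by move=> l lt_il; rewrite eq_i ?eq_j // -eq_ij.
Qed.

Lemma wrevlex_gt_total a b : a != b -> gt a b || gt b a.
Proof.
move=> neq_ab; have [lt_ab|lt_ba|eq_d] := ltngtP (wdeg w a) (wdeg w b).
- by apply/orP; right; apply/wrevlex_gtP; left.
- by apply/orP; left; apply/wrevlex_gtP; left.
have /existsP[i0 neq_i0]: [exists i, a i != b i].
  rewrite -negb_forall; apply: contra neq_ab => /forallP eq_ab.
  by apply/eqP/mnmP => i; apply/eqP.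
(* The largest index at which the exponents differ decides the comparison. *)
case: (@arg_maxnP _ i0 (fun i => a i != b i) val neq_i0) => i neq_i max_i.
have eq_j (j : 'I_k) : (i < j)%N -> a j = b j.
  by move=> lt_ij; apply: contraTeq lt_ij => /max_i; rewrite -leqNgt.
apply/orP; move: neq_i; rewrite neq_ltn => /orP[lt_i|lt_i]; [left|right].
  by apply/wrevlex_gtP; right; split=> //; exists i.
by apply/wrevlex_gtP; right; split=> //; exists i => // j /eq_j.
Qed.

Lemma wrevlex_gtD2r c a b : gt (a + c)%MM (b + c)%MM = gt a b.
Proof.
apply/wrevlex_gtP/wrevlex_gtP; rewrite !wdegD ltn_add2r => -[lt_ab|];
  [by left| |by left|]; case=> /eqP eq_ab [i lt_i eq_j]; right.
- split; first by apply/eqP; rewrite -(eqn_add2r (wdeg w c)).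
  exists i; first by move: lt_i; rewrite !mnmDE ltn_add2r.
  by move=> j /eq_j/eqP; rewrite !mnmDE eqn_add2r => /eqP.
- split; first by rewrite (eqP eq_ab).
  exists i; first by rewrite !mnmDE ltn_add2r.
  by move=> j /eq_j; rewrite !mnmDE => ->.
Qed.

Definition wrevlex_ge a b := (a == b) || gt a b.

Lemma wrevlex_gexx a : wrevlex_ge a a.
Proof. by rewrite /wrevlex_ge eqxx. Qed.

Lemma wrevlex_gtW a b : gt a b -> wrevlex_ge a b.
Proof. by rewrite /wrevlex_ge orbC => ->. Qed.

Lemma wrevlex_ge_gt_trans b a c : wrevlex_ge a b -> gt b c -> gt a c.
Proof. by case/predU1P=> [->//|]; apply: wrevlex_gt_trans. Qed.

Lemma wrevlex_gt_ge_trans b a c : gt a b -> wrevlex_ge b c -> gt a c.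
Proof. by move=> gt_ab /predU1P[<-//|]; apply: wrevlex_gt_trans. Qed.

Lemma wrevlex_ge_trans b a c :
  wrevlex_ge a b -> wrevlex_ge b c -> wrevlex_ge a c.
Proof.
case/predU1P=> [->//|gt_ab ge_bc].
by apply: wrevlex_gtW; apply: wrevlex_gt_ge_trans ge_bc.
Qed.

Lemma wrevlex_geD2r c a b : wrevlex_ge (a + c)%MM (b + c)%MM = wrevlex_ge a b.
Proof. by rewrite /wrevlex_ge eqm_add2r wrevlex_gtD2r. Qed.

Lemma wrevlex_geNgt a b : wrevlex_ge a b = ~~ gt b a.
Proof.
rewrite /wrevlex_ge; case: eqVneq => [->|/wrevlex_gt_total].
  by rewrite wrevlex_gtxx.
case: (boolP (gt b a)) => [gt_ba _|]; last by rewrite orbF.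
by apply/negP => /(wrevlex_gt_trans gt_ba); rewrite wrevlex_gtxx.
Qed.

Hypothesis w_gt0 : forall i, (0 < w i)%N.

Lemma mdeg_le_wdeg m : (mdeg m <= wdeg w m)%N.
Proof.
by rewrite mdegE; apply: leq_sum => i _; rewrite leq_pmulr.
Qed.

(** Positive weights bound the total degree by the weighted degree, so only finitely many monomials
    lie below a given one. Their number drops strictly at each descent. *)
Lemma wrevlex_wf : well_founded (fun a b => gt b a).
Proof.
move=> m0; have [d] : exists d, (wdeg w m0 < d)%N.
  by exists (wdeg w m0).+1.
pose below m := [set x : 'X_{1..k < d} | gt m x].
move: {2}#|_|.+1 (ltnSn #|below m0|) => l.
elim: l m0 => [m0|l IHl m0 lt_l lt_d]; first by rewrite ltn0.
constructor => m gt_m.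
have lt_md: (wdeg w m < d)%N := leq_ltn_trans (wrevlex_gt_wdeg gt_m) lt_d.
apply: (IHl); last exact: lt_md.
apply: (@leq_trans #|below m0|); last exact: lt_l.
apply/proper_card/properP; split.
  by apply/subsetP => x; rewrite !inE; apply: wrevlex_gt_trans.
exists (BMultinom (leq_ltn_trans (mdeg_le_wdeg m) lt_md)).
  by rewrite inE.
by rewrite inE wrevlex_gtxx.
Qed.

End WeightedRevlex.

(** * Leading monomials, initial ideals and multivariate division *)

Section LeadingMonomials.
Variables (K : fieldType) (k : nat) (w : 'I_k -> nat).
Implicit Types (m u : 'X_{1..k}) (p q r f g : {mpoly K[k]}).
Local Notation gt := (wrevlex_gt w).
Local Notation ge := (wrevlex_ge w).

(** The relation of the termination arguments. Phrased through supports, it also holds between a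
    nonzero [p] and [q = 0], which has no leading monomial. *)
Definition supp_gt p q : Prop :=
  exists2 m, m \in msupp p & forall m', m' \in msupp q -> gt m m'.

Definition lead_test p m : bool :=
  (m \in msupp p) && all (fun m' => (m' == m) || gt m m') (msupp p).

Lemma lead_testP p m : reflect (is_lead_mnm w p m) (lead_test p m).
Proof.
apply: (iffP andP) => -[p_m]; [move/allP|] => gt_m; split=> //.
  by move=> m' /gt_m /predU1P[->|//]; rewrite eqxx.
by apply/allP => m' /gt_m; case: eqP => //= _; apply.
Qed.

Lemma is_lead_mnmP p m :
  is_lead_mnm w p m <->
  m \in msupp p /\ forall m', m' \in msupp p -> ge m m'.
Proof.
split=> -[p_m gt_m]; split=> // m' p_m'.
  by rewrite /wrevlex_ge; case: eqVneq => //= ne; apply: gt_m; rewrite // eq_sym.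
by have /predU1P[->|//] := gt_m _ p_m'; rewrite eqxx.
Qed.

Lemma seq_max_wrevlex (s : seq 'X_{1..k}) :
  s != [::] -> exists2 m, m \in s & forall m', m' \in s -> ge m m'.
Proof.
elim: s => // x s IHs _; have [->|/IHs[m s_m max_m]] := eqVneq s [::].
  by exists x; rewrite ?inE // => m'; rewrite inE => /eqP->; apply: wrevlex_gexx.
have [ge_mx|] := boolP (ge m x).
  by exists m; rewrite ?inE ?s_m ?orbT // => m' /predU1P[->|/max_m].
rewrite wrevlex_geNgt negbK => gt_xm; exists x; rewrite ?mem_head // => m'.
case/predU1P=> [->|/max_m]; first exact: wrevlex_gexx.
by move=> ge_m; apply/wrevlex_gtW/wrevlex_gt_ge_trans/ge_m.
Qed.

Lemma lead_exists p : p != 0 -> exists m, is_lead_mnm w p m.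
Proof.
rewrite -msupp_eq0 => /seq_max_wrevlex[m p_m max_m].
by exists m; apply/is_lead_mnmP.
Qed.

Lemma lead_neq0 p m : is_lead_mnm w p m -> p@_m != 0.
Proof. by case; rewrite mcoeff_msupp. Qed.

Lemma supp_gt_cancel p q m :
    is_lead_mnm w p m -> is_lead_mnm w q m ->
  supp_gt p (p - (p@_m / q@_m) *: q).
Proof.
move=> lead_p lead_q; have [p_m /= gt_p] := lead_p.
have [_ gt_q] := lead_q.
exists m => // m'; have [->|ne_m'] := eqVneq m' m.
  by rewrite mcoeff_msupp mcoeffB mcoeffZ divfK ?subrr ?eqxx ?lead_neq0.
move/msuppB_le; rewrite mem_cat => /orP[p_m'|/msuppZ_le q_m'].
  exact: gt_p.
exact: gt_q.
Qed.

Lemma lead_mulX p m u :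
  is_lead_mnm w p m -> is_lead_mnm w (p * 'X_[u]) (m + u)%MM.
Proof.
case/is_lead_mnmP=> p_m ge_m; apply/is_lead_mnmP; split.
  by rewrite mcoeff_msupp addmC mcoeffMX -mcoeff_msupp.
move=> m'; rewrite (perm_mem (msuppMX p u)) => /mapP[m1 /ge_m ge_m1 ->].
by rewrite [(u + _)%MM]addmC wrevlex_geD2r.
Qed.

Lemma lead_X m : is_lead_mnm w ('X_[m] : {mpoly K[k]}) m.
Proof. by split; rewrite msuppX ?mem_head // => m'; rewrite inE => /eqP->; rewrite eqxx. Qed.

Lemma ideal_gen_supp (S : {mpoly K[k]} -> Prop) p u :
    ideal_gen S p -> u \in msupp p ->
  exists q m, [/\ S q, m \in msupp q & (m <= u)%MM].
Proof.
case=> s gen_s -> u_p.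
have /msupp_sum_le/flattenP[_ /mapP[x] s_x ->] := u_p.
move/msuppM_le/allpairsP=> [[m1 m2] /= [_ m2_x ->]].
exists x.2, m2; split=> //; last exact: lem_addl.
by apply: gen_s; move: s_x; rewrite mem_filter.
Qed.

Lemma ideal_gen_le (S : {mpoly K[k]} -> Prop) m u :
  S 'X_[m] -> (m <= u)%MM -> ideal_gen S 'X_[u].
Proof.
move=> S_m le_mu; exists [:: ('X_[u - m], 'X_[m])].
  by move=> x; rewrite inE => /eqP->.
by rewrite big_seq1 /= -mpolyXD submK.
Qed.

(** In an ideal generated by monomials, every monomial is a multiple of a single generator. *)
Lemma initial_idealP (S : {mpoly K[k]} -> Prop) u :
  initial_ideal w S 'X_[u] <->
  exists p m, [/\ S p, is_lead_mnm w p m & (m <= u)%MM].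
Proof.
split=> [in_u|[p [m [S_p lead_p le_mu]]]].
  have u_u: u \in msupp ('X_[u] : {mpoly K[k]}) by rewrite msuppX mem_head.
  have [_ [m' [[p [m [S_p lead_p ->]]]]]] := ideal_gen_supp in_u u_u.
  by rewrite msuppX inE => /eqP-> le_mu; exists p, m.
by apply: (ideal_gen_le (m := m)) => //; exists p, m.
Qed.

Lemma initial_ideal_supp (S : {mpoly K[k]} -> Prop) p u :
  initial_ideal w S p -> u \in msupp p -> initial_ideal w S 'X_[u].
Proof.
move=> in_p p_u.
have [_ [m' [[q [m [S_q lead_q ->]]]]]] := ideal_gen_supp in_p p_u.
rewrite msuppX inE => /eqP-> le_mu.
by apply/initial_idealP; exists q, m.
Qed.

Lemma initial_ideal_le (S : {mpoly K[k]} -> Prop) m u :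
  initial_ideal w S 'X_[m] -> (m <= u)%MM -> initial_ideal w S 'X_[u].
Proof.
case/initial_idealP=> p [m' [S_p lead_p le_m]] le_mu.
apply/initial_idealP; exists p, m'; split=> //; exact: lepm_trans le_mu.
Qed.

(** A boolean, because [G] is finite: for a Gröbner basis it decides which monomials lie in the
    initial ideal. *)
Definition lead_dvd (G : seq {mpoly K[k]}) u : bool :=
  has (fun g => has (fun m => lead_test g m && (m <= u)%MM) (msupp g)) G.

Lemma lead_dvdP (G : seq {mpoly K[k]}) u :
  reflect (exists g m, [/\ g \in G, is_lead_mnm w g m & (m <= u)%MM])
          (lead_dvd G u).
Proof.
apply: (iffP hasP) => [[g Gg /hasP[m _ /andP[/lead_testP lead_m le_mu]]]|].
  by exists g, m.
case=> g [m [Gg lead_m le_mu]]; exists g => //; apply/hasP; exists m.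
  by case: lead_m.
by apply/andP; split=> //; apply/lead_testP.
Qed.

Lemma initial_ideal_seqP (G : seq {mpoly K[k]}) u :
  reflect (initial_ideal w (fun g => g \in G) 'X_[u]) (lead_dvd G u).
Proof.
by apply: (iffP (lead_dvdP G u)) => /initial_idealP.
Qed.

Hypothesis w_gt0 : forall i, (0 < w i)%N.

(** Well-founded induction on a monomial [m] bounding the support: a nonzero [q] below [p] is
    bounded by its own leading monomial, which is smaller than [m]. For the zero polynomial the
    induction hypothesis is vacuous. *)
Lemma supp_gt_ind (P : {mpoly K[k]} -> Prop) :
  (forall p, (forall q, supp_gt p q -> P q) -> P p) -> forall p, P p.
Proof.
move=> IH; have P_bound m p : (forall m', m' \in msupp p -> ge m m') -> P p.
  elim/(well_founded_ind (wrevlex_wf w_gt0)): m p => m IHm p ge_m.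
  apply: (IH) => q [m1 p_m1 gt_m1].
  have [->|/lead_exists[m2 /is_lead_mnmP[q_m2 ge_m2]]] := eqVneq q 0.
    by apply: IH => q0 [m0]; rewrite msupp0.
  apply: IHm ge_m2; apply: wrevlex_ge_gt_trans (ge_m _ p_m1) _.
  exact: gt_m1.
move=> p; have [->|/lead_exists[m /is_lead_mnmP[_]]] := eqVneq p 0.
  by apply: IH => q0 [m0]; rewrite msupp0.
exact: P_bound.
Qed.

(** This is the division algorithm: the leading term of [f] is either cancelled by a multiple of an
    element of [G] or moved to the remainder, and [supp_gt] decreases. *)
Lemma remainder_exists (G : seq {mpoly K[k]}) f :
  exists r, is_remainder w G f r.
Proof.
(* The bound on the quotients is restated on whole supports, so that it passes through sums and
   makes sense for [f = 0]. *)
suff [q [r [f_eq bound_q irr_r]]]: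
    exists (q : 'I_(size G) -> {mpoly K[k]}) r,
    [/\ f = \sum_(i < size G) q i * G`_i + r,
        forall i m, m \in msupp (q i * G`_i) ->
          exists2 m', m' \in msupp f & ge m' m &
        forall m, m \in msupp r -> ~~ lead_dvd G m].
  exists r, q; split=> //.
    move=> i m m' [/bound_q[m1 f_m1 ge_m1] _] /is_lead_mnmP[_ ge_m'].
    by have := wrevlex_ge_trans (ge_m' _ f_m1) ge_m1; rewrite /wrevlex_ge eq_sym.
  move=> g m m' Gg lead_g /irr_r; apply: contra => le_m.
  by apply/lead_dvdP; exists g, m.
elim/supp_gt_ind: f => f IHf.
have [->|/lead_exists[m lead_f]] := eqVneq f 0.
  exists (fun=> 0), 0; split=> [|i m|m]; last by rewrite msupp0.
    by rewrite addr0 big1 // => i _; rewrite mul0r.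
  by rewrite mul0r msupp0.
have f_m: m \in msupp f by case: lead_f.
have ge_f f' m' : supp_gt f f' -> m' \in msupp f' -> ge m m'.
  case=> m1 f_m1 gt_m1 /gt_m1 gt_m'; apply: wrevlex_gtW.
  case/is_lead_mnmP: lead_f => _ /(_ _ f_m1) ge_m.
  exact: wrevlex_ge_gt_trans gt_m'.
have [/lead_dvdP[g [mg [Gg lead_g le_mg]]]|irr_m] := boolP (lead_dvd G m).
  have lead_h := lead_mulX (m - mg)%MM lead_g.
  rewrite addmC submK // in lead_h; set h := g * _ in lead_h.
  have gt_f := supp_gt_cancel lead_f lead_h; set c := _ / _ in gt_f.
  have [q [r [f_eq bound_q irr_r]]] := IHf _ gt_f.
  (* The reducing factor is added to the quotient at the position of [g] in [G]. *)
  pose i0 := Ordinal (etrans (index_mem g G) Gg).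
  have G_i0: G`_i0 = g by rewrite nth_index.
  exists (fun i => q i + (if i == i0 then c *: 'X_[m - mg] else 0)), r; split=> //.
    under eq_bigr do rewrite mulrDl.
    rewrite big_split /= [X in _ + X + _](bigD1 i0) //= eqxx G_i0 -scalerAl mulrC.
    rewrite [X in _ *: _ + X]big1 ?addr0 => [|i /negbTE->]; last by rewrite mul0r.
    by rewrite addrAC -f_eq subrK.
  have old i m' : m' \in msupp (q i * G`_i) -> ge m m'.
    by case/bound_q=> m1 f_m1 /(wrevlex_ge_trans _); apply; apply: ge_f f_m1.
  move=> i m'; case: (i =P i0) => [->|_]; last by rewrite addr0 => /old; exists m.
  rewrite mulrDl => /msuppD_le; rewrite mem_cat => /orP[/old|]; first by exists m.
  rewrite G_i0 -scalerAl mulrC => /msuppZ_le.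
  by case/is_lead_mnmP: lead_h => _ ge_h /ge_h; exists m.
(* No leading monomial of [G] divides [m], so the leading term joins the remainder. *)
have gt_f := supp_gt_cancel lead_f (lead_X m).
rewrite mcoeffX eqxx divr1 in gt_f.
have [q [r [f_eq bound_q irr_r]]] := IHf _ gt_f.
exists q, (r + f@_m *: 'X_[m]); split.
- by rewrite addrA -f_eq subrK.
- move=> i m' /bound_q[m1 f_m1 ge_m1]; exists m => //.
  exact: wrevlex_ge_trans (ge_f _ _ gt_f f_m1) ge_m1.
move=> m'; move/msuppD_le; rewrite mem_cat => /orP[/irr_r//|/msuppZ_le].
by rewrite msuppX inE => /eqP->.
Qed.

End LeadingMonomials.

Lemma mcoeff_pihomog (R : nzRingType) (k : nat) (mf : measure k) d
    (p : {mpoly R[k]}) m :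
  (pihomog mf d p)@_m = if mf m == d then p@_m else 0.
Proof.
rewrite pihomogE raddf_sum /= big_mkcond /=.
have E m' : (if mf m' == d then (p@_m' *: 'X_[m'])@_m else 0)
    = if m' == m then (if mf m == d then p@_m else 0) else 0.
  rewrite mcoeffZ mcoeffX; case: (m' =P m) => [->|_]; first by rewrite mulr1.
  by rewrite mulr0 if_same.
under eq_bigr do rewrite E.
have [p_m|/memN_msupp_eq0->] := boolP (m \in msupp p); last first.
  by rewrite if_same big1 // => m'; rewrite if_same.
rewrite (bigD1_seq m p_m (msupp_uniq p)) /= eqxx big1 ?addr0 // => m'.
by move/negbTE->.
Qed.

(** * Splitting a monomial into its part in the first n variables and its part in y, z *)

Section TailVariables.
Variable n : nat.
Implicit Types (m u : 'X_{1..n + 2}) (a b : 'X_{1..2}).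

(** The head stays a monomial of R, to be compared with the members of B0, whereas [mtail] gives a
    monomial of A and [memb] embeds monomials of A into those of R. *)
Definition mhead m : 'X_{1..n + 2} :=
  [multinom if (i < n)%N then m i else 0%N | i < n + 2].

Definition mtail m : 'X_{1..2} := [multinom m (rshift n j) | j < 2].

Definition memb a : 'X_{1..n + 2} :=
  [multinom if split i is inr j then a j else 0%N | i < n + 2].

Lemma memb_rshift a j : memb a (rshift n j) = a j.
Proof. by rewrite mnmE (unsplitK (inr j)). Qed.

Lemma memb_lshift a i : memb a (lshift 2 i) = 0%N.
Proof. by rewrite mnmE (unsplitK (inl i)). Qed.

Lemma mhead_rshift m j : mhead m (rshift n j) = 0%N.
Proof. by rewrite mnmE /= ltnNge leq_addr. Qed.

Lemma mhead_lshift m i : mhead m (lshift 2 i) = m (lshift 2 i).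
Proof. by rewrite mnmE /= ltn_ord. Qed.

Lemma mnm_split_eq m u :
  (forall i, m (lshift 2 i) = u (lshift 2 i)) -> mtail m = mtail u -> m = u.
Proof.
move=> eq_l eq_r; apply/mnmP => i; rewrite -(splitK i).
case: (split i) => j //=.
by have /mnmP/(_ j) := eq_r; rewrite !mnmE.
Qed.

Lemma mtailD m u : mtail (m + u) = (mtail m + mtail u)%MM.
Proof. by apply/mnmP => j; rewrite !mnmE. Qed.

Lemma mtail_memb a : mtail (memb a) = a.
Proof. by apply/mnmP => j; rewrite mnmE memb_rshift. Qed.

Lemma mtail_mhead m : mtail (mhead m) = 0%MM.
Proof. by apply/mnmP => j; rewrite mnmE mhead_rshift mnmE. Qed.

Lemma mhead_tail m : (mhead m + memb (mtail m))%MM = m.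
Proof.
apply: mnm_split_eq => [i|]; first by rewrite mnmDE mhead_lshift memb_lshift addn0.
by rewrite mtailD mtail_mhead mtail_memb add0m.
Qed.

Lemma mheadD m u : mhead (m + u) = (mhead m + mhead u)%MM.
Proof. by apply/mnmP => i; rewrite !mnmE; case: ifP. Qed.

Lemma mhead_memb a : mhead (memb a) = 0%MM.
Proof.
apply: mnm_split_eq => [i|]; first by rewrite mhead_lshift memb_lshift mnmE.
by rewrite mtail_mhead; apply/mnmP => j; rewrite !mnmE.
Qed.

Lemma mhead_id m : mtail m = 0%MM -> mhead m = m.
Proof.
move=> m0; apply: mnm_split_eq => [i|]; first exact: mhead_lshift.
by rewrite mtail_mhead m0.
Qed.

Lemma mhead_addl u a : mtail u = 0%MM -> mhead (u + memb a) = u.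
Proof. by move=> u0; rewrite mheadD mhead_memb addm0 mhead_id. Qed.

Lemma mtail_addl u a : mtail u = 0%MM -> mtail (u + memb a) = a.
Proof. by move=> u0; rewrite mtailD mtail_memb u0 add0m. Qed.

Lemma membD a b : memb (a + b) = (memb a + memb b)%MM.
Proof.
apply: mnm_split_eq => [i|]; first by rewrite mnmDE !memb_lshift.
by rewrite mtailD !mtail_memb.
Qed.

Lemma memb0 : memb 0 = 0%MM.
Proof.
apply: mnm_split_eq => [i|]; first by rewrite !memb_lshift mnmE.
by rewrite mtail_memb; apply/mnmP => j; rewrite !mnmE.
Qed.

Lemma mtail_eq0 m :
  (mtail m == 0%MM) = (m (penult_var n) == 0%N) && (m (last_var n) == 0%N).
Proof.
apply/eqP/andP => [m0|[/eqP y0 /eqP z0]].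
  by split; apply/eqP; [have /mnmP/(_ ord0) := m0 | have /mnmP/(_ ord_max) := m0];
    rewrite !mnmE.
apply/mnmP => j; rewrite !mnmE; case: j => [[|[]] //] lt_j.
  by rewrite -[RHS]y0; congr (m _); apply/val_inj.
by rewrite -[RHS]z0; congr (m _); apply/val_inj.
Qed.

Lemma mtail0_le m u : (m <= u)%MM -> mtail u = 0%MM -> mtail m = 0%MM.
Proof.
move/mnm_lepP=> le_mu /mnmP u0; apply/mnmP => j; have := u0 j.
by have := le_mu (rshift n j); rewrite !mnmE => /[swap]->; rewrite leqn0 => /eqP.
Qed.

Lemma memb_tail2 b :
  memb b = (U_(penult_var n) *+ b ord0 + U_(last_var n) *+ b ord_max)%MM.
Proof.
apply: mnm_split_eq => [i|].
  rewrite memb_lshift mnmDE !mulmnE !mnm1E -!val_eqE /=.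
  by rewrite ![(n + _ == _)%N]gtn_eqF ?mul0n // (leq_trans (ltn_ord i)) ?leq_addr.
rewrite mtail_memb; apply/mnmP => j; rewrite mnmE mnmDE !mulmnE !mnm1E.
rewrite !(inj_eq (@rshift_inj _ _)).
case: j => [[|[]] //] lt_j; rewrite -!val_eqE /= ?mul0n ?mul1n ?addn0 ?add0n;
  congr (b _); exact/val_inj.
Qed.

Lemma wdeg_memb (w : 'I_(n + 2) -> nat) a :
  wdeg w (memb a) = wdeg (fun j => w (rshift n j)) a.
Proof.
rewrite /wdeg big_split_ord /= big1 => [|i _]; last by rewrite memb_lshift.
by rewrite add0n; apply: eq_bigr => j _; rewrite memb_rshift.
Qed.

Variable w : 'I_(n + 2) -> nat.

(** In equal degree the deciding index is either the last one, where [m] has the smaller exponent,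
    or an earlier one, and then the last exponents agree. *)
Lemma wrevlex_gt_last m m' :
  wdeg w m = wdeg w m' -> wrevlex_gt w m m' ->
  (m (last_var n) <= m' (last_var n))%N.
Proof.
move=> eq_d /wrevlex_gtP[|[_ [i lt_i eq_j]]]; first by rewrite eq_d ltnn.
have [<-|ne_i] := eqVneq i (last_var n); first exact: ltnW.
rewrite eq_j // ltn_neqAle ne_i /= addn1 -ltnS.
by apply: leq_trans (ltn_ord i) _; rewrite addn2.
Qed.

(** The deciding index cannot be one of the last two, where [m'] has exponent 0; hence the tails of
    [m] and [m'] agree. *)
Lemma wrevlex_gt_mtail0 m m' :
  wdeg w m = wdeg w m' -> wrevlex_gt w m m' ->
  mtail m' = 0%MM -> mtail m = 0%MM.
Proof.
move=> eq_d /wrevlex_gtP[|[_ [i lt_i eq_j]]]; first by rewrite eq_d ltnn.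
move=> m'0; rewrite -m'0; apply/mnmP => j; rewrite !mnmE; apply: eq_j.
move: lt_i; rewrite -{1 2}(splitK i); case: (splitP i) => l /= -> lt_l.
  by rewrite (leq_trans (ltn_ord l)) ?leq_addr.
by have /mnmP/(_ l) := m'0; move: lt_l; rewrite !mnmE => /[swap] ->.
Qed.

Lemma wrevlex_gt_mtail m m' :
    wdeg w m = wdeg w m' -> mtail m = 0%MM -> mtail m' != 0%MM ->
  wrevlex_gt w m m'.
Proof.
move=> eq_d m0 m'0; have ne_m: m != m' by apply: contraNneq m'0 => <-; apply/eqP.
case/orP: (wrevlex_gt_total w ne_m) => // /wrevlex_gt_mtail0 gt_m.
by case/eqP: m'0; apply: gt_m.
Qed.

End TailVariables.

(** * The initial ideal of I: regularity of z, the sets B0 and B1, finiteness of B0 *)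

Section InitialIdeal.
Variables (K : fieldType) (n : nat) (w : 'I_(n + 2) -> nat).
Variable I : idealr {mpoly K[n + 2]}.
Implicit Types (m u : 'X_{1..n + 2}) (a b : 'X_{1..2}) (p q : {mpoly K[n + 2]}).
Local Notation yv := (penult_var n).
Local Notation zv := (last_var n).

Lemma iotaA_X b : iotaA n ('X_[b] : {mpoly K[2]}) = 'X_[memb n b].
Proof.
rewrite /iotaA comp_mpolyX; under eq_bigr do rewrite tnth_mktuple.
rewrite mprodXnE memb_tail2 !big_ord_recl big_ord0 Monoid.mulm1.
by congr ('X_[_ + U_(_) *+ b _]); do ?congr (rshift n _); apply/val_inj.
Qed.

Lemma iotaAZ (c : K) (g : {mpoly K[2]}) : iotaA n (c *: g) = c *: iotaA n g.
Proof. exact: comp_mpolyZ. Qed.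

Lemma iotaAE (g : {mpoly K[2]}) :
  iotaA n g = \sum_(b <- msupp g) g@_b *: 'X_[memb n b].
Proof.
rewrite /iotaA comp_mpolyEX; apply: eq_bigr => b _.
by rewrite -[X in _ *: X = _]/(iotaA n _) iotaA_X.
Qed.

Lemma msupp_iotaA (g : {mpoly K[2]}) m :
  m \in msupp (iotaA n g) -> exists2 b, b \in msupp g & m = memb n b.
Proof.
rewrite iotaAE => /msupp_sum_le/flattenP[_ /mapP[b g_b ->]] /msuppZ_le.
by rewrite msuppX inE => /eqP->; exists b => //; move: g_b; rewrite filter_predT.
Qed.

Lemma chi_X m : chi ('X_[m] : {mpoly K[n + 2]}) = 'X_[mhead m].
Proof.
rewrite /chi comp_mpolyX mpolyXE_id; apply: eq_bigr => i _.
by rewrite tnth_mktuple mnmE; case: ifP => // _; rewrite expr1n expr0.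
Qed.

Lemma msupp_chi p u : u \in msupp (chi p) -> exists2 m, m \in msupp p & u = mhead m.
Proof.
rewrite /chi comp_mpolyEX => /msupp_sum_le/flattenP[_ /mapP[m p_m ->]] /msuppZ_le.
rewrite -[X in msupp X]/(chi _) chi_X msuppX inE => /eqP->.
by exists m => //; move: p_m; rewrite filter_predT.
Qed.

Lemma cls_eq0 p : (cls I p == 0) = (p \in I).
Proof. by rewrite -[p in RHS]subr0 Quotient.idealrBE -[X in _ == X](rmorph0 (cls I)). Qed.

Hypothesis I_homog : whomogeneous_ideal w (fun p => p \in I).

(** Multiplying by a monomial moves the leading monomial to [u] itself, and the homogeneous
    component in the degree of [u] keeps it. *)
Lemma initI_P u :
  initI I w 'X_[u] <->
  exists p, [/\ p \in I, p \is (wdeg w u).-homog for (wdeg w) & is_lead_mnm w p u].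
Proof.
split=> [/initial_idealP[p [m [I_p lead_p le_mu]]]|[p [I_p _ lead_p]]]; last first.
  by apply/initial_idealP; exists p, u; split=> //; apply: lepm_refl.
have := lead_mulX (u - m)%MM lead_p; rewrite addmC submK // => -[q_u gt_q].
set q := p * _ in q_u gt_q; have I_q: q \in I by rewrite /q mulrC idealMr.
exists (pihomog (wdeg w) (wdeg w u) q); split; [exact: I_homog|exact: pihomogP|].
split; first by rewrite mcoeff_msupp mcoeff_pihomog eqxx -mcoeff_msupp.
move=> m'; rewrite mcoeff_msupp mcoeff_pihomog.
case: ifP => [_|]; last by rewrite eqxx.
by rewrite -mcoeff_msupp; apply: gt_q.
Qed.

Lemma initI_last u :
  GRing.lreg (cls I 'X_zv) -> initI I w 'X_[u + U_(zv)] -> initI I w 'X_[u].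
Proof.
move=> z_reg /initI_P[p [I_p homog_p lead_p]].
(* All monomials of [p] have the same degree, so none has a smaller exponent of z than the leading
   one. *)
have p_z m : m \in msupp p -> (U_(zv) <= m)%MM.
  case/is_lead_mnmP: lead_p => _ ge_p p_m; rewrite lep1mP -lt0n.
  have z_u: (0 < (u + U_(zv))%MM zv)%N by rewrite mnmDE mnm1E eqxx addn1.
  case/predU1P: (ge_p _ p_m) => [<- //|/wrevlex_gt_last gt_m].
  by apply: leq_trans z_u (gt_m _); rewrite (dhomog_mf homog_p p_m).
pose q := \sum_(m <- msupp p) p@_m *: 'X_[m - U_(zv)].
have p_eq: p = q * 'X_zv.
  rewrite {1}[p]mpolyE mulr_suml; apply: eq_big_seq => m /p_z le_m.
  by rewrite -scalerAl -mpolyXD submK.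
have I_q: q \in I.
  rewrite -cls_eq0; apply/eqP/z_reg; rewrite mulr0 -rmorphM mulrC -p_eq.
  by apply/eqP; rewrite cls_eq0.
apply/initial_idealP; exists q, u; split; [by []| |exact: lepm_refl].
case/is_lead_mnmP: lead_p => p_u ge_p; apply/is_lead_mnmP.
have supp_q m : (m \in msupp q) = ((m + U_(zv))%MM \in msupp p).
  by rewrite !mcoeff_msupp p_eq addmC mcoeffMX.
split; first by rewrite supp_q.
by move=> m; rewrite supp_q => /ge_p; rewrite wrevlex_geD2r.
Qed.

Lemma initI_lastn u d :
  GRing.lreg (cls I 'X_zv) -> initI I w 'X_[u + U_(zv) *+ d] -> initI I w 'X_[u].
Proof.
move=> z_reg; elim: d => [|d IHd]; first by rewrite mulm0n addm0.
by rewrite mulmSr addmA => /(initI_last z_reg).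
Qed.

(** Elements of (y, z) have only monomials with nonzero tail, and these are smaller than every
    tail-free monomial of the same degree. Adding such an element therefore leaves the tail-free
    leading monomials unchanged. *)
Lemma inB0_P u : inB0 I w u <-> mtail u = 0%MM /\ ~ initI I w 'X_[u].
Proof.
have yz_tail q m :
    ideal_gen (fun q => q = 'X_yv \/ q = 'X_zv) q -> m \in msupp q -> mtail m != 0%MM.
  move=> gen_q /(ideal_gen_supp gen_q)[_ [m' [[]-> ]]].
    by rewrite msuppX inE => /eqP->; rewrite lep1mP mtail_eq0 => /negbTE->.
  by rewrite msuppX inE => /eqP->; rewrite lep1mP mtail_eq0 andbC => /negbTE->.
split=> [B0_u|[u0 in_u]].
  split; last first.
    case/initial_idealP=> p [m [I_p lead_p le_mu]]; apply: B0_u.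
    apply/initial_idealP; exists p, m; split=> //.
    by exists p, 0; split; rewrite ?addr0 //; exists [::]; rewrite ?big_nil.
  apply/eqP; apply/negPn/negP; rewrite mtail_eq0 negb_and => /orP u_yz.
  have [i ci ui]: exists2 i, i = yv \/ i = zv & (U_(i) <= u)%MM.
    by case: u_yz => nz; [exists yv | exists zv]; rewrite ?lep1mP; auto.
  apply: B0_u; apply/initial_idealP; exists 'X_i, U_(i)%MM; split=> //;
    last exact: lead_X.
  exists 0, 'X_i; split; rewrite ?add0r ?rpred0 //.
  apply: (ideal_gen_le (m := U_(i)%MM)); last exact: lepm_refl.
  by case: ci => ->; [left|right].
case/initial_idealP=> p [m [[q [s [I_q gen_s p_eq]]] lead_p le_mu]]; apply: in_u.
have m0 := mtail0_le le_mu u0.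
apply: (initial_ideal_le (m := m)) le_mu; apply/initial_idealP.
(* [q] and [p] agree on tail-free monomials, among them [m]; the other monomials of [q] in the
   degree of [m] are below [m]. *)
exists (pihomog (wdeg w) (wdeg w m) q), m; split; [exact: I_homog| |exact: lepm_refl].
have q_eq m' : mtail m' = 0%MM -> q@_m' = p@_m'.
  move=> m'0; rewrite p_eq mcoeffD [s@_m']memN_msupp_eq0 ?addr0 //.
  by apply: contraPN m'0 => /(yz_tail _ _ gen_s)/eqP.
have [p_m gt_p] := lead_p; split.
  by rewrite mcoeff_msupp mcoeff_pihomog eqxx q_eq // -mcoeff_msupp.
move=> m'; rewrite mcoeff_msupp mcoeff_pihomog.
case: ifP => [/eqP eq_d|]; last by rewrite eqxx.
have [m'0|m'0 _ _] := eqVneq (mtail m') 0%MM; last exact: wrevlex_gt_mtail.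
by rewrite q_eq // -mcoeff_msupp; apply: gt_p.
Qed.

(** Since [chi] sets y and z to 1, membership in J means that some u y^a z^b lies in in(I), and
    regularity of z removes the factor z^b. *)
Lemma inB1_P u :
  GRing.lreg (cls I 'X_zv) ->
  inB1 I w u <-> inB0 I w u /\ exists d, initI I w 'X_[u + U_(yv) *+ d].
Proof.
move=> z_reg; split=> -[B0_u J_u]; split=> //; last first.
  case: J_u => d in_ud; have [u0 _] := iffLR (inB0_P u) B0_u.
  apply: (ideal_gen_le (m := u)); last exact: lepm_refl.
  exists 'X_[u + U_(yv) *+ d]; rewrite // chi_X.
  have ->: (U_(yv) *+ d)%MM = memb n (U_(ord0) *+ d).
    rewrite memb_tail2 !mulmnE !mnm1E eqxx mul1n mul0n.
    by rewrite mulm0n addm0.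
  by rewrite mhead_addl.
have u_u: u \in msupp ('X_[u] : {mpoly K[n + 2]}) by rewrite msuppX mem_head.
have [_ [m [[p in_p ->] chi_m le_mu]]] := ideal_gen_supp J_u u_u.
have [m1 p_m1 m_eq] := msupp_chi chi_m.
exists (mtail m1 ord0); apply: (initI_lastn (d := mtail m1 ord_max)) => //.
apply: initial_ideal_le (initial_ideal_supp in_p p_m1) _.
rewrite -addmA -memb_tail2 -{1}(mhead_tail m1) -m_eq.
apply/mnm_lepP => i; rewrite !mnmDE leq_add2r; exact: mnm_lepP.
Qed.

Hypothesis w_gt0 : forall i, (0 < w i)%N.
Hypothesis integralA : integralRange (structA I).

(** An integral equation of x_i over A lifts to a polynomial of I with top term x_i^d. In its
    component of the degree of x_i^d every other monomial involves y or z, hence is smaller. *)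
Lemma initI_pow (i : 'I_n) : exists d, initI I w 'X_[U_(lshift 2 i) *+ d].
Proof.
set x := lshift 2 i; have [p mon_p root_p] := integralA (cls I 'X_x).
have sz_p: (0 < size p)%N by rewrite lt0n size_poly_eq0 monic_neq0.
pose d := (size p).-1; exists d.
pose q := \sum_(j < d) iotaA n p`_j * 'X_x ^+ j.
have I_q: q + 'X_[U_(x) *+ d] \in I.
  rewrite -cls_eq0; move/rootP: root_p => /eqP; congr (_ == 0).
  rewrite (@horner_coef_wide _ (size p)) ?size_poly // rmorphD rmorph_sum.
  rewrite -(prednK sz_p) big_ord_recr /= -/d; congr (_ + _).
    by apply: eq_bigr => j _; rewrite coef_map_id0 ?rmorph0 // rmorphM rmorphXn.
  rewrite coef_map_id0 ?rmorph0 // -[p`_d]/(lead_coef p) (monicP mon_p) rmorph1 mul1r.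
  by rewrite -mpolyXn rmorphXn.
have x_tail j: mtail (U_(x) *+ j)%MM = 0%MM.
  by apply/mnmP => l; rewrite mnmE mulmnE mnm1E eq_lrshift mnm0E.
have q_supp m : m \in msupp q ->
    exists (j : 'I_d) b, m = (U_(x) *+ j + memb n b)%MM.
  move/msupp_sum_le/flattenP=> [_ /mapP[j _ ->]] /msuppM_le/allpairsP[[m1 m2] /=].
  case=> /msupp_iotaA[b _ ->]; rewrite mpolyXn msuppX inE => /eqP-> ->.
  by exists j, b; rewrite addmC.
have x_eq j b : (U_(x) *+ j + memb n b)%MM x = j.
  by rewrite mnmDE memb_lshift mulmnE mnm1E eqxx mul1n addn0.
set e := (U_(x) *+ d)%MM in I_q *; apply/initial_idealP.
exists (pihomog (wdeg w) (wdeg w e) (q + 'X_[e])), e.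
split; [exact: I_homog| |exact: lepm_refl].
have q_e: e \notin msupp q.
  apply/negP => /q_supp[j [b /(congr1 (fun m : 'X_{1..n + 2} => m x))]].
  by rewrite x_eq mulmnE mnm1E eqxx mul1n => eq_d; have := ltn_ord j; rewrite -eq_d ltnn.
split.
  rewrite mcoeff_msupp mcoeff_pihomog eqxx mcoeffD memN_msupp_eq0 //.
  by rewrite mcoeffX eqxx add0r oner_eq0.
move=> m; rewrite mcoeff_msupp mcoeff_pihomog.
case: ifP => [/eqP eq_m|]; last by rewrite eqxx.
rewrite -mcoeff_msupp => /msuppD_le; rewrite mem_cat msuppX inE orbC.
case: eqP => //= _ /q_supp[j [b m_eq]] _.
have m_tail: mtail m = b by rewrite m_eq mtail_addl.
(* With zero tail, [m] would be a power x^j with j < d, which cannot have the degree of x^d because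
   the weight of x is positive. *)
apply: wrevlex_gt_mtail; [by rewrite eq_m|exact: x_tail|]; rewrite m_tail; apply/eqP => b0.
have x_wdeg l: wdeg w (U_(x) *+ l)%MM = (l * w x)%N.
  rewrite /wdeg (bigD1 x) //= mulmnE mnm1E eqxx mul1n big1 ?addn0 // => i0 ne_i.
  by rewrite mulmnE mnm1E eq_sym (negbTE ne_i).
have /eqP: wdeg w m = wdeg w e := eq_m.
rewrite m_eq b0 memb0 addm0 /e !x_wdeg eqn_pmul2r // => /eqP eq_d.
by have := ltn_ord j; rewrite eq_d ltnn.
Qed.

(** The last two exponents vanish, and each other exponent is at most that of a power of the
    variable lying in in(I). This is what makes B0 finite. *)
Lemma inB0_bounded : exists d, forall u, inB0 I w u -> (mdeg u < d)%N.
Proof.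
have [d in_d] := fin_all_exists initI_pow.
exists (\sum_(i < n) d i).+1 => u /inB0_P[u0 in_u]; rewrite ltnS mdegE big_split_ord /=.
rewrite [X in (_ + X)%N]big1 ?addn0 => [|j _]; last first.
  by have /mnmP/(_ j) := u0; rewrite !mnmE.
apply: leq_sum => i _; rewrite leqNgt; apply/negP => lt_d; apply: in_u.
apply: initial_ideal_le (in_d i) _; apply/mnm_lepP => j; rewrite mulmnE mnm1E.
by case: eqP => [<-|]; rewrite ?mul1n ?mul0n // ltnW.
Qed.

End InitialIdeal.

(** * Elements of a free A-module on monomials, read as polynomials *)

Section FreePart.
Variables (K : fieldType) (n : nat) (B : {fset 'X_{1..n + 2}}).
Hypothesis B_tail : forall v, v \in B -> mtail v = 0%MM.
Local Notation A := {mpoly K[2]}.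
Local Notation R := {mpoly K[n + 2]}.
Implicit Types (g h : {ffun B -> A^o}) (v : B).

(** The lift of [psi0] to R before passing to the quotient; it gives module elements a support and a
    leading monomial. *)
Definition from_free g : R := \sum_(v : B) iotaA n (g v : A) * 'X_[val v].

Lemma from_free_is_linear a g h :
  from_free (a *: g + h) = iotaA n a * from_free g + from_free h.
Proof.
rewrite /from_free mulr_sumr -big_split /=; apply: eq_bigr => v _.
by rewrite !ffunE rmorphD rmorphM mulrDl mulrA.
Qed.

Fact from_free_is_zmod_morphism : zmod_morphism from_free.
Proof.
move=> g h; rewrite addrC -scaleN1r from_free_is_linear rmorphN1 mulN1r.
exact: addrC.
Qed.

HB.instance Definition _ := GRing.isZmodMorphism.Build {ffun B -> A^o} R
  from_free from_free_is_zmod_morphism.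

Lemma from_freeZ a g : from_free (a *: g) = iotaA n a * from_free g.
Proof. by rewrite -[a *: g]addr0 from_free_is_linear raddf0 addr0. Qed.

Lemma msupp_from_free g m :
  m \in msupp (from_free g) ->
  exists v, mhead m = val v /\ mtail m \in msupp (g v : A).
Proof.
move/msupp_sum_le/flattenP=> [_ /mapP[v _ ->]] /msuppM_le/allpairsP[[m1 m2] /=].
case=> /msupp_iotaA[b g_b ->]; rewrite msuppX inE => /eqP-> ->.
have v0 := B_tail (valP v); exists v.
by rewrite addmC mhead_addl ?mtail_addl.
Qed.

Lemma mcoeff_iotaA (a : A) b : (iotaA n a)@_(memb n b) = a@_b.
Proof.
rewrite iotaAE [in RHS](mpolyE a) !raddf_sum; apply: eq_bigr => c _ /=.
by rewrite !mcoeffZ !mcoeffX (inj_eq (can_inj (@mtail_memb n))).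
Qed.

(** Members of [B] are tail-free, so the head of a monomial determines [v] and only one summand
    contributes. *)
Lemma mcoeff_from_free g v b : (from_free g)@_(val v + memb n b)%MM = (g v : A)@_b.
Proof.
rewrite /from_free raddf_sum (bigD1 v) //= mcoeffMX mcoeff_iotaA big1 ?addr0 //.
move=> v' ne_v; apply: memN_msupp_eq0; apply: contra ne_v.
move/msuppM_le/allpairsP=> [[m1 m2] /=] [/msupp_iotaA[c _ ->]].
rewrite msuppX inE => /eqP-> /(congr1 (@mhead n)).
rewrite [(memb _ _ + _)%MM]addmC !mhead_addl ?(B_tail (valP v)) ?(B_tail (valP v')) //.
by move/val_inj->.
Qed.

Lemma from_free_eq0 g : from_free g = 0 -> g = 0.
Proof.
move=> g0; apply/ffunP => v; apply/mpolyP => b.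
by rewrite -mcoeff_from_free g0 ffunE !mcoeff0.
Qed.

Lemma from_free_basis v : from_free (basis_vec A B (val v)) = 'X_[val v].
Proof.
rewrite /from_free (bigD1 v) //= ffunE eqxx rmorph1 mul1r big1 ?addr0 // => v' ne_v.
by rewrite ffunE (inj_eq val_inj) (negbTE ne_v) rmorph0 mul0r.
Qed.

Lemma from_free_surj (p : R) :
  (forall m, m \in msupp p -> mhead m \in B) -> exists g, from_free g = p.
Proof.
move=> p_B; rewrite [p]mpolyE; elim: (msupp p) p_B => [|m s IHs] s_B.
  by exists 0; rewrite raddf0 big_nil.
have [|g g_eq] := IHs; first by move=> m' s_m'; apply: s_B; rewrite inE s_m' orbT.
have B_m: mhead m \in B by apply: s_B; rewrite mem_head.
exists ((p@_m *: 'X_[mtail m]) *: basis_vec A B (mhead m) + g).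
rewrite from_free_is_linear g_eq big_cons (from_free_basis [` B_m]%fset).
by rewrite iotaAZ iotaA_X -scalerAl -mpolyXD addmC mhead_tail.
Qed.

End FreePart.

(** * Remainders modulo a Gröbner basis *)

Section NormalForms.
Variables (K : fieldType) (n : nat) (w : 'I_(n + 2) -> nat).
Variables (I : idealr {mpoly K[n + 2]}) (G : seq {mpoly K[n + 2]}).
Implicit Types (m u : 'X_{1..n + 2}) (p q r : {mpoly K[n + 2]}).
Hypothesis I_homog : whomogeneous_ideal w (fun p => p \in I).
Hypothesis groebnerG : groebner_basis w (fun p => p \in I) G.

Lemma lead_dvd_initI u : reflect (initI I w 'X_[u]) (lead_dvd w G u).
Proof.
by apply: (iffP (initial_ideal_seqP w G u)) => in_u; apply/(proj2 groebnerG).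
Qed.

Lemma normal_form_eq0 p :
  p \in I -> (forall m, m \in msupp p -> ~ initI I w 'X_[m]) -> p = 0.
Proof.
move=> I_p irr_p; apply/eqP/negPn/negP => /(lead_exists w)[m lead_p].
apply: (irr_p m); first by case: lead_p.
by apply/initial_idealP; exists p, m; split=> //; apply: lepm_refl.
Qed.

Lemma remainder_irr p r m :
  is_remainder w G p r -> m \in msupp r -> ~ initI I w 'X_[m].
Proof.
case=> q [_ _ irr_r] r_m /lead_dvd_initI/lead_dvdP[g [m' [Gg lead_g]]].
exact/negP/(irr_r g).
Qed.

Lemma remainder_ideal p r : is_remainder w G p r -> p - r \in I.
Proof.
case=> q [-> _ _]; rewrite addrK; apply: rpred_sum => i _.
by apply: idealMr; apply: (proj1 groebnerG); apply: mem_nth.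
Qed.

(** All monomials of the difference other than [u] lie outside in(I), whereas its leading monomial
    lies inside, so that one is [u]. The components in other degrees lie in I and have no monomial
    in in(I), hence vanish. *)
Lemma remainder_monomial u r :
    initI I w 'X_[u] -> is_remainder w G 'X_[u] r ->
  [/\ 'X_[u] - r \in I, ('X_[u] - r) \is (wdeg w u).-homog for (wdeg w),
      is_lead_mnm w ('X_[u] - r) u & ('X_[u] - r)@_u = 1].
Proof.
move=> in_u rem_r; have I_p := remainder_ideal rem_r; set p := _ - r in I_p *.
have p_r m : m != u -> p@_m = - r@_m.
  by move=> ne_m; rewrite mcoeffB mcoeffX eq_sym (negbTE ne_m) sub0r.
have irr_p m : m != u -> m \in msupp p -> ~ initI I w 'X_[m].
  move=> ne_m; rewrite mcoeff_msupp p_r // oppr_eq0 -mcoeff_msupp.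
  exact: remainder_irr rem_r.
have p_u: p@_u = 1.
  rewrite mcoeffB mcoeffX eqxx memN_msupp_eq0 ?subr0 //.
  by apply/negP => /(remainder_irr rem_r).
have [m lead_p]: exists m, is_lead_mnm w p m.
  by apply: lead_exists; apply: contraTneq (oner_neq0 K) => p0; rewrite -p_u p0 mcoeff0 eqxx.
split=> //; last first.
  have [<- //|ne_m] := eqVneq m u; case: (irr_p m) => //; first by case: lead_p.
  by apply/initial_idealP; exists p, m; split=> //; apply: lepm_refl.
apply/dhomogP => m' p_m'; apply/eqP/negPn/negP => ne_d.
have: pihomog (wdeg w) (wdeg w m') p = 0.
  apply: normal_form_eq0 => [|m1]; first exact: I_homog.
  rewrite mcoeff_msupp mcoeff_pihomog; case: ifP => [/eqP eq_d|]; last by rewrite eqxx.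
  by rewrite -mcoeff_msupp; apply: irr_p; apply: contra ne_d => /eqP <-; rewrite eq_d.
move/(congr1 (mcoeff m')); rewrite mcoeff_pihomog eqxx mcoeff0 => /eqP.
by rewrite mcoeff_eq0 p_m'.
Qed.

End NormalForms.

(** * Exactness, gradedness and minimality of the complex *)

Section Resolution.
Variables (K : fieldType) (n : nat) (w : 'I_(n + 2) -> nat).
Variables (I : idealr {mpoly K[n + 2]}) (G : seq {mpoly K[n + 2]}).
Local Notation A := {mpoly K[2]}.
Local Notation R := {mpoly K[n + 2]}.
Local Notation yv := (penult_var n).
Local Notation zv := (last_var n).
Hypothesis w_gt0 : forall i, (0 < w i)%N.
Hypothesis I_homog : whomogeneous_ideal w (fun p => p \in I).
Hypothesis groebnerG : groebner_basis w (fun p => p \in I) G.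
Hypothesis z_reg : GRing.lreg (cls I 'X_zv).

Variables (B0 B1 : {fset 'X_{1..n + 2}}).
Hypothesis B0P : forall u, u \in B0 <-> inB0 I w u.
Hypothesis B1P : forall u, u \in B1 <-> inB1 I w u.
Variable delta : B1 -> nat.
Hypothesis deltaP : forall u : B1, is_delta I w (val u) (delta u).
Local Notation F0 := {ffun B0 -> A^o}.
Local Notation F1 := {ffun B1 -> A^o}.
Implicit Types (u : B1) (v : B0) (m : 'X_{1..n + 2}).

Lemma B0_tail m : m \in B0 -> mtail m = 0%MM.
Proof. by move/(iffLR (B0P m))/(iffLR (inB0_P I_homog m)) => -[]. Qed.

Lemma B0_notin_initI m : m \in B0 -> ~ initI I w 'X_[m].
Proof. by move/(iffLR (B0P m))/(iffLR (inB0_P I_homog m)) => -[]. Qed.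

Lemma B1_sub_B0 u : val u \in B0.
Proof. by apply/B0P; have /B1P[] := valP u. Qed.

Lemma mhead_B0 m : ~ initI I w 'X_[m] -> mhead m \in B0.
Proof.
move=> irr_m; apply/(B0P (mhead m))/(inB0_P I_homog); rewrite mtail_mhead; split=> //.
move=> in_h; apply: irr_m; apply: initial_ideal_le in_h _.
by rewrite -{2}(mhead_tail m) lem_addr.
Qed.

Lemma remainder_from_free p r :
  is_remainder w G p r -> exists g : F0, from_free g = r.
Proof.
move=> rem_r; apply: from_free_surj => m r_m; apply: mhead_B0.
exact: remainder_irr rem_r r_m.
Qed.

Lemma psi0E (g : F0) : psi0 I B0 g = cls I (from_free g).
Proof.
rewrite /psi0 /hom_of_basis rmorph_sum; apply: eq_bigr => v _.
by rewrite rmorphM.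
Qed.

Definition lead_of u : 'X_{1..n + 2} := (val u + U_(yv) *+ delta u)%MM.

Lemma lead_ofE u : lead_of u = (val u + memb n (U_(ord0) *+ delta u))%MM.
Proof.
rewrite memb_tail2 !mulmnE !mnm1E eqxx mul1n mul0n.
by rewrite mulm0n addm0.
Qed.

Lemma lead_of_initI u : initI I w 'X_[lead_of u].
Proof. by have [] := deltaP u; rewrite mpolyXn -mpolyXD. Qed.

Lemma mtail_lead_of u : mtail (lead_of u) = (U_(ord0) *+ delta u)%MM.
Proof. by rewrite lead_ofE mtail_addl // B0_tail ?B1_sub_B0. Qed.

Lemma delta_gt0 u : (0 < delta u)%N.
Proof.
rewrite lt0n; apply/eqP => d0; apply: (B0_notin_initI (B1_sub_B0 u)).
by have := lead_of_initI u; rewrite /lead_of d0 mulm0n addm0.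
Qed.

Lemma mtail_lead_of_neq0 u : mtail (lead_of u) != 0%MM.
Proof.
rewrite mtail_lead_of; apply/eqP => /mnmP/(_ ord0)/eqP.
by rewrite mulmnE mnm1E eqxx mul1n mnm0E -leqn0 leqNgt delta_gt0.
Qed.

Lemma wdeg_lead_of u : wdeg w (lead_of u) = (wdeg w (val u) + delta u * w yv)%N.
Proof.
rewrite lead_ofE wdegD wdeg_memb /wdeg !big_ord_recl big_ord0 !mulmnE !mnm1E.
by rewrite eqxx mul1n !addn0.
Qed.

(** Write m as u y^a z^b with u its head. Regularity of z puts u y^a into in(I), so u is in B1, and
    minimality of [delta] gives a >= delta_u. *)
Lemma lead_in_B1 m :
    initI I w 'X_[m] -> mhead m \in B0 ->
  exists u c, m = (lead_of u + memb n c)%MM.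
Proof.
move=> in_m B0_m; have in_y: initI I w 'X_[mhead m + U_(yv) *+ mtail m ord0].
  apply: (initI_lastn I_homog (d := mtail m ord_max) z_reg).
  by rewrite -addmA -memb_tail2 mhead_tail.
have B1_m: mhead m \in B1.
  apply/B1P/(inB1_P I_homog _ z_reg); split; first exact/B0P.
  by exists (mtail m ord0).
pose u : B1 := [` B1_m]%fset; exists u, (mtail m - U_(ord0) *+ delta u)%MM.
have le_d: (delta u <= mtail m ord0)%N.
  by have [_] := deltaP u; apply; rewrite mpolyXn -mpolyXD.
rewrite lead_ofE -addmA -membD -{1}(mhead_tail m); congr (_ + memb n _)%MM.
rewrite addmC submK //; apply/mnm_lepP => j; rewrite mulmnE mnm1E.
by case: eqP => [<-|]; rewrite ?mul1n ?mul0n.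
Qed.

Variable f : B1 -> B0 -> A.
Hypothesis fP : division_coeffs w G delta f.

Definition psi1_col u : F0 :=
  ('X_ord0 ^+ delta u : A) *: basis_vec A B0 (val u)
    - \sum_(v : B0) f u v *: basis_vec A B0 (val v).

Lemma psi1E h : psi1 delta f h = \sum_u (h u : A) *: psi1_col u.
Proof. by []. Qed.

(** The polynomial of I that psi1(e_u) stands for: u y^(delta_u) minus its remainder. *)
Definition syzygy u : R := from_free (psi1_col u).

Lemma syzygyE u :
  syzygy u = 'X_[lead_of u] - \sum_(v : B0) iotaA n (f u v) * 'X_[val v].
Proof.
rewrite /syzygy raddfB /= from_freeZ.
rewrite (from_free_basis K [` B1_sub_B0 u]%fset) mpolyXn iotaA_X -mpolyXD.
rewrite addmC -lead_ofE.
congr (_ - _); rewrite raddf_sum; apply: eq_bigr => v _.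
by rewrite /= from_freeZ from_free_basis.
Qed.

Lemma syzygyP u :
  [/\ syzygy u \in I, syzygy u \is (wdeg w (lead_of u)).-homog for (wdeg w),
      is_lead_mnm w (syzygy u) (lead_of u) & (syzygy u)@_(lead_of u) = 1].
Proof.
rewrite syzygyE; apply: (remainder_monomial I_homog groebnerG (lead_of_initI u)).
by have := fP u; rewrite mpolyXn -mpolyXD.
Qed.

(** The leading monomial involves y since [delta u] is positive, and a tail-free monomial of the
    same degree would be larger than it. *)
Lemma syzygy_mtail u m : m \in msupp (syzygy u) -> mtail m != 0%MM.
Proof.
have [_ homog_u lead_u _] := syzygyP u => s_m.
case/is_lead_mnmP: lead_u => _ /(_ _ s_m) /predU1P[<-|gt_m].
  exact: mtail_lead_of_neq0.
apply: contra (mtail_lead_of_neq0 u) => /eqP m0.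
apply/eqP; apply: wrevlex_gt_mtail0 gt_m m0.
by rewrite (dhomog_mf homog_u s_m).
Qed.

Lemma from_free_psi1 h :
  from_free (psi1 delta f h) = \sum_u iotaA n (h u : A) * syzygy u.
Proof. by rewrite psi1E raddf_sum; apply: eq_bigr => u _; rewrite /= from_freeZ. Qed.

(** Reduces both the degree count and minimality to the monomials of the syzygies. *)
Lemma msupp_psi1 h v b :
  b \in msupp (psi1 delta f h v : A) ->
  exists u b1 b2, [/\ b = (b1 + b2)%MM, b1 \in msupp (h u : A) &
    (val v + memb n b2)%MM \in msupp (syzygy u)].
Proof.
rewrite psi1E sum_ffunE => /msupp_sum_le/flattenP[_ /mapP[u _ ->]].
rewrite ffunE => /msuppM_le/allpairsP[[b1 b2] /= [h_b1 c_b2 ->]].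
exists u, b1, b2; split=> //.
by rewrite mcoeff_msupp mcoeff_from_free -?mcoeff_msupp //; exact: B0_tail.
Qed.

Lemma psi1_homog d h :
    free_homog (fun j => w (rshift n j))
      (fun u : B1 => (wdeg w (val u) + delta u * w yv)%N) d h ->
  free_homog (fun j => w (rshift n j)) (fun v : B0 => wdeg w (val v)) d
    (psi1 delta f h).
Proof.
move=> h_d v b /msupp_psi1[u [b1 [b2 [-> /h_d <-]]]].
have [_ homog_u _ _] := syzygyP u => /(dhomog_mf homog_u) eq_d.
have {}eq_d: wdeg w (val v + memb n b2)%MM = wdeg w (lead_of u) := eq_d.
by rewrite -wdeg_lead_of -eq_d !wdegD wdeg_memb -addnA [X in (_ + X)%N]addnC.
Qed.

Lemma psi0_homog d g :
    free_homog (fun j => w (rshift n j)) (fun v : B0 => wdeg w (val v)) d g ->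
  quo_homog w d (psi0 I B0 g).
Proof.
move=> g_d; exists (from_free g); last exact: psi0E.
apply/dhomogP => m /(msupp_from_free B0_tail)[v [m_v /g_d <-]].
by rewrite -[LHS]/(wdeg w m) -{1}(mhead_tail m) wdegD wdeg_memb m_v addnC.
Qed.

Lemma psi1_minimal h v : (psi1 delta f h v : A)@_0%MM = 0.
Proof.
apply: memN_msupp_eq0; apply/negP => /msupp_psi1[u [b1 [b2 [b0 _]]]].
move/eqP: b0; rewrite eq_sym mnmD_eq0 => /andP[_ /eqP->].
by rewrite memb0 addm0 => /syzygy_mtail; rewrite B0_tail ?eqxx ?(valP v).
Qed.

(* The leading terms of the products [h u * syzygy u] lie in distinct free
   summands, so the largest of them cannot cancel. *)
Lemma psi1_ker h : psi1 delta f h = 0 -> h = 0.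
Proof.
move=> h0; have B1_tail m : m \in B1 -> mtail m = 0%MM.
  by move=> B1_m; apply/B0_tail/(B1_sub_B0 [` B1_m]%fset).
(* [h'] replaces each syzygy by its leading monomial. As an element of a free module on B1, it has
   no cancellation between different [u]. *)
pose h' : F1 := [ffun u => 'X_[U_(ord0) *+ delta u] * (h u : A)].
have h'E: from_free h' = \sum_u iotaA n (h u : A) * 'X_[lead_of u].
  apply: eq_bigr => u _; rewrite ffunE rmorphM /= iotaA_X lead_ofE mpolyXD.
  by rewrite mulrAC mulrC [_ * 'X_[val u]]mulrC.
have msupp_h' u b : (lead_of u + memb n b)%MM \in msupp (from_free h') =
    (b \in msupp (h u : A)).
  rewrite lead_ofE -addmA -membD !mcoeff_msupp mcoeff_from_free // ffunE.
  by rewrite mulrC mcoeffMX.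
have h'_eq: from_free h' =
    \sum_u iotaA n (h u : A) * ('X_[lead_of u] - syzygy u).
  under [RHS]eq_bigr do rewrite mulrBr.
  by rewrite sumrB -from_free_psi1 h0 raddf0 subr0.
have [h'0|/(lead_exists w)[m /is_lead_mnmP[]]] := eqVneq (from_free h') 0.
  apply/ffunP => u; apply/mpolyP => b; rewrite ffunE mcoeff0.
  by apply: memN_msupp_eq0; rewrite -msupp_h' h'0 msupp0.
rewrite {1}h'_eq => /msupp_sum_le/flattenP[_ /mapP[u _ ->]] /msuppM_le/allpairsP.
case=> -[m1 m2] /= [/msupp_iotaA[b h_b ->] u_m2 ->] ge_h.
have [_ _ lead_u lead_u1] := syzygyP u.
have gt_m2: wrevlex_gt w (lead_of u) m2.
  have := supp_gt_cancel (lead_X K w (lead_of u)) lead_u.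
  rewrite mcoeffX eqxx lead_u1 divr1 scale1r => -[m3].
  by rewrite msuppX inE => /eqP->; apply.
(* The leading monomial of [from_free h'] is the product of [memb n b] and [m2], but replacing [m2]
   by [lead_of u] gives a larger monomial of the same polynomial. *)
have := ge_h (lead_of u + memb n b)%MM; rewrite msupp_h' => /(_ h_b).
by rewrite addmC wrevlex_geD2r wrevlex_geNgt gt_m2.
Qed.

Lemma psi0_ker g : psi0 I B0 g = 0 -> exists h, g = psi1 delta f h.
Proof.
(* The induction runs on the polynomial [p], with [g] free to vary. *)
move=> /eqP; rewrite psi0E cls_eq0; move: {2}(from_free g) (erefl (from_free g)) => p.
elim/(@supp_gt_ind K _ _ w_gt0): p g => p IHp g gp I_p.
have [p0|/(lead_exists w)[m lead_p]] := eqVneq p 0.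
  by exists 0; rewrite raddf0; apply: (from_free_eq0 B0_tail); rewrite gp.
have in_m: initI I w 'X_[m].
  by apply/initial_idealP; exists p, m; split; [rewrite -gp|by []|exact: lepm_refl].
have B0_m: mhead m \in B0.
  have: m \in msupp (from_free g) by rewrite gp; case: lead_p.
  by case/(msupp_from_free B0_tail) => v [-> _]; apply: valP.
have [u [c m_eq]] := lead_in_B1 in_m B0_m.
have [I_u _ lead_u lead_u1] := syzygyP u.
have lead_q := lead_mulX (memb n c) lead_u; rewrite -m_eq in lead_q.
have q_m: (syzygy u * 'X_[memb n c])@_m = 1.
  by rewrite m_eq addmC mcoeffMX.
have gt_p := supp_gt_cancel lead_p lead_q; rewrite q_m divr1 in gt_p.
(* The multiple of e_u whose image under [psi1] has the same leading term as [p]. *)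
pose h1 : F1 := [ffun u' => if u' == u then (p@_m *: 'X_[c] : A) else 0].
have psi1_e: from_free (psi1 delta f h1) = p@_m *: (syzygy u * 'X_[memb n c]).
  rewrite from_free_psi1 (bigD1 u) //= big1 => [|u' ne_u].
    by rewrite addr0 ffunE eqxx iotaAZ iotaA_X -scalerAl mulrC.
  by rewrite ffunE (negbTE ne_u) rmorph0 mul0r.
have [||h h_eq] := IHp _ gt_p (g - psi1 delta f h1).
- by rewrite raddfB /= gp psi1_e.
- rewrite raddfB /= psi1_e -mul_mpolyC; apply: rpredB I_p _.
  by rewrite idealMr // mulrC idealMr.
by exists (h + h1); rewrite raddfD /= -h_eq subrK.
Qed.

Lemma psi0_psi1 h : psi0 I B0 (psi1 delta f h) = 0.
Proof.
rewrite psi0E; apply/eqP; rewrite cls_eq0 from_free_psi1.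
by apply: rpred_sum => u _; rewrite idealMr //; case: (syzygyP u).
Qed.

(** The remainder of a representative has only monomials outside in(I), and their heads lie in
    B0. *)
Lemma psi0_surj z : exists g, psi0 I B0 g = z.
Proof.
have -> : z = cls I (repr z) by rewrite /cls reprK.
have [r rem_r] := remainder_exists w_gt0 G (repr z).
have [g g_eq] := remainder_from_free rem_r; exists g.
rewrite psi0E g_eq; apply/eqP; rewrite eq_sym -subr_eq0 -rmorphB cls_eq0.
exact: (remainder_ideal groebnerG rem_r).
Qed.

Lemma noether_resolution_psi :
  noether_resolution w (fun v : B0 => wdeg w (val v))
    (fun u : B1 => (wdeg w (val u) + delta u * w yv)%N)
    (psi1 delta f) (psi0 I B0).
Proof.
split; first by split; [apply: psi1_homog|apply: psi0_homog].
- move=> h1 h2 eq_h; apply/eqP; rewrite -subr_eq0; apply/eqP/psi1_ker.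
  by rewrite raddfB /= eq_h subrr.
- move=> g; split; [exact: psi0_ker|by case=> h ->; apply: psi0_psi1].
- exact: psi0_surj.
- exact: psi1_minimal.
Qed.

End Resolution.

(** * Construction of B0, B1 and delta by finite tests, and the resolution *)

Theorem theorem1 (K : fieldType) (n : nat) (w : 'I_(n + 2) -> nat)
    (I : idealr {mpoly K[n + 2]}) (G : seq {mpoly K[n + 2]})
    (K_infinite : forall s : seq K, exists x : K, x \notin s)
    (w_gt0 : forall i, (0 < w i)%N)
    (I_homog : whomogeneous_ideal w (fun p => p \in I))
    (dimRI : krull_dim_eq (quo I) 2)
    (noetherA : noether_normalization I)
    (xn_regular : GRing.lreg (cls I 'X_(last_var n)))
    (groebnerG : groebner_basis w (fun p => p \in I) G) :
  exists B0 B1 : {fset 'X_{1..n + 2}},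
  exists delta : B1 -> nat,
    [/\ forall u, u \in B0 <-> inB0 I w u,
        forall u, u \in B1 <-> inB1 I w u,
        forall u : B1, is_delta I w (val u) (delta u),
        exists f : B1 -> B0 -> {mpoly K[2]}, division_coeffs w G delta f &
        forall f : B1 -> B0 -> {mpoly K[2]}, division_coeffs w G delta f ->
          noether_resolution w
            (fun v : B0 => wdeg w (val v))
            (fun u : B1 => (wdeg w (val u) + delta u * w (penult_var n))%N)
            (psi1 delta f)
            (psi0 I B0)].
Proof.
have initP u := lead_dvd_initI groebnerG u.
have [d lt_d] := inB0_bounded I_homog w_gt0 (proj2 noetherA).
pose isB0 (u : 'X_{1..n + 2}) := (mtail u == 0%MM) && ~~ lead_dvd w G u.
(* The degree bound [d] confines B0 to a finite set of monomials, from which a boolean test selects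
   it. *)
pose B0 := [fset u in codom (@bmnm (n + 2) d) | isB0 u]%fset.
have isB0P u : reflect (inB0 I w u) (isB0 u).
  apply: (iffP andP) => [[/eqP u0 /initP in_u]|/(inB0_P I_homog)[u0 in_u]].
    exact/(inB0_P I_homog).
  by split; [apply/eqP|apply/initP].
have B0P u : u \in B0 <-> inB0 I w u.
  rewrite !inE /=; split=> [/andP[_ /isB0P //]|B0_u]; apply/andP; split.
    by apply/codomP; exists (BMultinom (lt_d _ B0_u)).
  exact/isB0P.
(* N exceeds every exponent of a leading monomial of G, so that u y^N decides
   whether some u y^e lies in the initial ideal. *)
pose N := (\sum_(g <- G) msize g)%N.
pose B1 := [fset u in B0 | lead_dvd w G (u + U_(penult_var n) *+ N)]%fset.
have B1E u : (u \in B1) = (u \in B0) && lead_dvd w G (u + U_(penult_var n) *+ N).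
  by rewrite !inE.
have B1P u : u \in B1 <-> inB1 I w u.
  rewrite B1E; split=> [/andP[/B0P B0_u /initP in_u]|].
    by apply/(inB1_P I_homog _ xn_regular); split=> //; exists N.
  case/(inB1_P I_homog _ xn_regular)=> /B0P B0_u [e /initP/lead_dvdP].
  move=> [g [m [Gg lead_g le_m]]]; apply/andP; split; first exact: B0_u.
  apply/lead_dvdP; exists g, m; split=> //; apply/mnm_lepP => i.
  move/mnm_lepP: le_m => /(_ i); rewrite !mnmDE !mulmnE !mnm1E.
  case: eqP => [<- _|_]; last by rewrite !mul0n.
  rewrite mul1n; apply: leq_trans (leq_addl _ _).
  rewrite /N (big_rem g Gg) /=; apply: leq_trans (leq_addr _ _).
  apply: leq_trans (ltnW (msize_mdeg_lt (proj1 lead_g))).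
  by rewrite mdegE (bigD1 (penult_var n)) //= leq_addr.
(* The exponent [N] is a witness, and the boolean test lets a least one be chosen. *)
have deltaP (u : B1) : exists e, is_delta I w (val u) e.
  have: exists e, lead_dvd w G (val u + U_(penult_var n) *+ e)%MM.
    by exists N; have := valP u; rewrite B1E => /andP[].
  case/ex_minnP => e /initP in_e min_e; exists e.
  rewrite /is_delta mpolyXn -mpolyXD; split=> // e'.
  by rewrite mpolyXn -mpolyXD => /initP/min_e.
have {deltaP}[delta deltaP] := fin_all_exists deltaP.
exists B0, B1, delta; split; [exact: B0P|exact: B1P|exact: deltaP| |].
  have remP (u : B1) : exists g : {ffun B0 -> {mpoly K[2]}^o},
      is_remainder w G ('X_[val u] * 'X_(penult_var n) ^+ delta u) (from_free g).
    have [r rem_r] := remainder_exists w_gt0 G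
      ('X_[val u] * 'X_(penult_var n) ^+ delta u).
    have [g g_eq] := remainder_from_free I_homog groebnerG B0P rem_r.
    by exists g; rewrite g_eq.
  have [g gP] := fin_all_exists remP.
  by exists g.
move=> f fP; exact: (noether_resolution_psi w_gt0 I_homog groebnerG).
Qed.
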